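(* Let $G$ be a Hausdorff topological group whose underlying space is paracompact and an $F$-space, with $\dim G<\infty$ and $\psi(G)\le\omega$. Then $G$ contains an open Boolean subgroup $H$ which is itself a paracompact topological $F$-group with $\dim H<\infty$ and $\psi(H)\le\omega$.
   Context: All spaces are Tychonoff (completely regular Hausdorff). A space $X$ is an $F$-space if any two disjoint cozero sets in $X$ are completely (functionally) separated in $X$. $\dim X$ denotes the Čech covering dimension: the least integer $n\ge -1$ such that every finite open cover of $X$ has a finite open refinement of order $n$ (and $\infty$ if no such $n$ exists). $\psi(G)$ is the pseudocharacter; for a topological group, $\psi(G)\le\omega$ means that the identity element is a $G_\delta$-set. A group is Boolean if all its elements satisfy $x^2=1$. *)

(* Defs.v *)
From HB Require Import structures.
From mathcomp Require Import all_boot all_order all_algebra.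
From mathcomp Require Import all_classical all_reals all_analysis.
From mathcomp Require Import Rstruct Rstruct_topology.
Set Implicit Arguments. Unset Strict Implicit. Unset Printing Implicit Defensive.
Import Order.TTheory GRing.Theory Num.Theory.
Local Open Scope classical_set_scope.
Local Open Scope ring_scope.

Notation Rl := Rdefinitions.R.

Definition topological_group (T : topologicalType)
  (mul : T -> T -> T) (inv : T -> T) (e : T) : Prop :=
  [/\ (forall x y z, mul x (mul y z) = mul (mul x y) z),
      (forall x, mul e x = x /\ mul x e = x),
      (forall x, mul (inv x) x = e /\ mul x (inv x) = e),
      continuous (fun p : T * T => mul p.1 p.2) &
      continuous inv].

Definition cozero (T : topologicalType) (f : T -> Rl) : set T :=
  [set x | f x != 0].

Definition completely_separated (T : topologicalType) (A B : set T) : Prop :=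
  exists f : T -> Rl, continuous f /\
    (forall x, A x -> f x = 0) /\ (forall x, B x -> f x = 1).

Definition F_space (T : topologicalType) : Prop :=
  forall f g : T -> Rl, continuous f -> continuous g ->
    cozero f `&` cozero g = set0 ->
    completely_separated (cozero f) (cozero g).

Definition refines (T : Type) (D C : set (set T)) : Prop :=
  forall V, D V -> exists2 U, C U & V `<=` U.

Definition open_cover (T : topologicalType) (C : set (set T)) : Prop :=
  (forall U, C U -> open U) /\ (forall x, exists2 U, C U & U x).

Definition locally_finite_family (T : topologicalType) (D : set (set T)) : Prop :=
  forall x : T, exists2 N, nbhs x N &
    finite_set [set V | D V /\ V `&` N !=set0].

Definition paracompact (T : topologicalType) : Prop :=
  hausdorff_space T /\
  forall C : set (set T), open_cover C ->
    exists D : set (set T), [/\ open_cover D, refines D C & locally_finite_family D].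

Definition order_le (T : Type) (D : set (set T)) (n : nat) : Prop :=
  forall (x : T) (s : seq (set T)), uniq s ->
    (forall V, V \in s -> D V /\ V x) -> (size s <= n.+1)%N.

Definition covering_dim_le (T : topologicalType) (n : nat) : Prop :=
  forall C : set (set T), finite_set C -> open_cover C ->
    exists D : set (set T),
      [/\ finite_set D, open_cover D, refines D C & order_le D n].

Definition finite_dim (T : topologicalType) : Prop :=
  exists n : nat, covering_dim_le T n.

Definition Gdelta_point (T : topologicalType) (a : T) : Prop :=
  exists U : nat -> set T, (forall k, open (U k)) /\ \bigcap_k U k = [set a].

(* Main.v *)
(** If the elements of order at most two contain a neighbourhood [U] of [e],
then a neighbourhood [V] with [V V] inside [U] is commutative, and it generates
an open Boolean subgroup; this is clopen, so it inherits all properties of [G].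

To find [U], call a real function [f] odd if [f (inv x) = - f x]. In an F-space
the sets [f > 0] and [f < 0] are completely separated and exchanged by [inv], so
[e] lies in the closure of neither, and [f] vanishes near [e]. It remains to
produce finitely many odd functions without a common zero on
[Y = {x | x x <> e}].

Since [e] is a G-delta point, [Y] is exhausted by sets of points moved by a fixed
entourage of a countable uniformity, and Stone's argument for the paracompactness
of metric spaces yields countably many odd [f k] without a common zero on [Y].
With [Phi] the sum of the [|f k| / 2 ^ k.+1], finitely many of them suffice on
[Phi >= a > 0]. There a finite refinement of order [n] of the cover by the sets
[f k > 0] and [f k < 0] has subordinate functions [g j], and at every point
between 1 and [2 n + 2] of the odd functions [u j = g j - g j \o inv] are nonzero;
hence the [2 n + 2] power sums of odd exponent of the [u j], suitably weighted,
have no common zero. As their number does not depend on [a], these families can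
be glued along disjoint annuli [a' < Phi < a'']. *)

Require Import Defs.
From HB Require Import structures.
From mathcomp Require Import all_boot all_order all_algebra.
From mathcomp Require Import all_classical all_reals all_analysis.
From mathcomp Require Import Rstruct Rstruct_topology.
From mathcomp Require wochoice.
From mathcomp Require Import ring lra.
Import Order.TTheory GRing.Theory Num.Theory.
Import numFieldNormedType.Exports.
Local Open Scope classical_set_scope.
Local Open Scope ring_scope.

(** * Normality of paracompact spaces *)

(** Serves twice: with [B] a point it lifts Hausdorff to regular, then with [B] closed it lifts
    regular to normal. *)
Lemma paracompact_separation (X : topologicalType) (A B : set X) :
  paracompact X -> closed A ->
  (forall a, A a -> exists U, [/\ open U, U a & closure U `&` B = set0]) ->
  exists W, [/\ open W, A `<=` W & closure W `&` B = set0].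
Proof.
move=> [_ pX] cA sepA.
pose C : set (set X) :=
  [set U | open U /\ (closure U `&` B = set0 \/ U = ~` A)].
have coverC : open_cover C.
  split=> [U [] //|x]; have [/sepA[U [oU Ux UB]]|nAx] := pselect (A x).
    by exists U => //; split=> //; left.
  by exists (~` A) => //; split; [exact: closed_openC|right].
have [D [[oD covD] DC lfD]] := pX C coverC.
pose S := [set V | D V /\ closure V `&` B = set0].
exists (\bigcup_(V in S) V); split.
- by apply: bigcup_open => V [/oD].
- move=> a Aa; have [V DV Va] := covD a; exists V => //; split=> //.
  have [U [_ [UB|UA]] VU] := DC V DV; last by have := VU a Va; rewrite UA.
  by apply/seteqP; split=> // x [/(closureS VU) ? ?]; rewrite -UB; split.
- apply/seteqP; split=> // b [clb Bb].
  (* Only finitely many members of [S] meet [N]; removing their closures, which miss [b], leaves a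
     neighbourhood of [b] disjoint from the union. *)
  have [N Nb finN] := lfD b.
  pose F := [set V | D V /\ V `&` N !=set0] `&` S.
  have finF : finite_set F by apply: sub_finite_set finN => V [].
  have clF : closed (\bigcup_(V in F) closure V).
    by apply: closed_bigcup => // V _; exact: closed_closure.
  have : nbhs b (N `&` ~` \bigcup_(V in F) closure V).
    apply: filterI => //; apply: open_nbhs_nbhs; split; first exact: closed_openC.
    by move=> [V [_ [_ VB]] cVb]; have : (closure V `&` B) b by []; rewrite VB.
  move=> /clb[y [[V SV Vy] [Ny]]]; apply; exists V; last exact: subset_closure.
  by split=> //; split; [case: SV|exists y].
Qed.

Lemma paracompact_normal (X : topologicalType) :
  paracompact X -> normal_space X.
Proof.
move=> pX; have [hX _] := pX.
have regX (B : set X) x : closed B -> ~ B x ->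
    exists U, [/\ open U, U x & closure U `&` B = set0].
  move=> cB nBx.
  have [|W [oW BW Wx]] := @paracompact_separation X B [set x] pX cB.
    move=> b Bb; have bx : b != x by apply/eqP => bx; apply: nBx; rewrite -bx.
    have := hX; rewrite open_hausdorff => /(_ _ _ bx)[[U V] /=].
    rewrite !inE => -[Ub Vx] [oU oV UV0]; exists U; split=> //.
    apply/seteqP; split=> // y [+ yx]; rewrite yx => clUx.
    have [z [Uz Vz]] : U `&` V !=set0 by apply: clUx; exact: open_nbhs_nbhs.
    by have : (U `&` V) z by []; rewrite UV0.
  exists (~` closure W); split; first exact/closed_openC/closed_closure.
    by move=> ?; have : (closure W `&` [set x]) x by []; rewrite Wx.
  have cW : closed (~` W) by exact: open_closedC.
  apply/seteqP; split=> // y [cy /BW Wy].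
  suff : (~` W) y by [].
  apply: cW; apply: closureS cy; apply: subsetC; exact: subset_closure.
apply/(@normal_openP Rl) => A B cA cB AB0.
have [|W [oW AW WB]] := @paracompact_separation X A B pX cA.
  by move=> a Aa; apply: regX => // Ba; have : (A `&` B) a by []; rewrite AB0.
exists W, (~` closure W); split=> //; first exact/closed_openC/closed_closure.
- by move=> y By clWy; have : (closure W `&` B) y by []; rewrite WB.
- by apply/seteqP; split=> // y [/subset_closure].
Qed.

Lemma normal_urysohn (R : realType) (X : topologicalType) (A B : set X) :
  normal_space X -> closed A -> closed B -> A `&` B = set0 ->
  exists f : X -> R, [/\ continuous f, forall x, 0 <= f x <= 1,
    forall x, A x -> f x = 0 & forall x, B x -> f x = 1].
Proof.
move=> /(@normal_separatorP R)/[apply]/[apply]/[apply].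
case/(@uniform_separatorP _ R) => f [cf f01 fA fB]; exists f; split=> //.
- by move=> x; have := f01 (f x); rewrite /= in_itv /=; apply; exists x.
- by move=> x Ax; apply: fA; exists x.
- by move=> x Bx; apply: fB; exists x.
Qed.

(** Induction on [p]: a Urysohn function for [V p] that is 1 on the part of [C] missed by the
    earlier [V j] has a zero set in [C] covered by those. *)
Lemma subordinate_functions (R : realType) (X : topologicalType)
    (V : nat -> set X) (p : nat) (C : set X) :
  normal_space X -> (forall j, open (V j)) -> closed C ->
  (forall x, C x -> exists2 j, (j < p)%N & V j x) ->
  exists g : nat -> X -> R, [/\ forall j, continuous (g j),
    forall j x, 0 <= g j x,
    forall j x, g j x != 0 -> V j x &
    forall x, C x -> exists2 j, (j < p)%N & g j x != 0].
Proof.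
move=> nX oV; elim: p C => [|p IH] C cC covC.
  exists (fun _ _ => 0); split=> //; last by move=> x /covC[].
  - by move=> j; exact: cst_continuous.
  - by move=> j x; rewrite eqxx.
have cV : closed (\bigcap_(j in `I_p) ~` V j).
  by apply: closed_bigI => j _; exact: open_closedC.
have [||f [cf f01 f0 f1]] := @normal_urysohn R X (~` V p)
    (C `&` \bigcap_(j in `I_p) ~` V j) nX (open_closedC (oV p)).
- exact: closedI.
- apply/seteqP; split=> // x [nVp [/covC[j]]].
  rewrite ltnS leq_eqVlt => /predU1P[-> //|jp Vj] /(_ j jp); exact.
have [||g [cg g0 gV gC]] := IH (C `&` f @^-1` [set 0]).
- apply: closedI => //; apply: (proj1 (continuous_closedP f) cf).
  exact: closed_eq.
- move=> x [Cx fx0]; apply: contrapT => nVx.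
  have /f1 : (C `&` \bigcap_(j in `I_p) ~` V j) x.
    by split=> // j jp Vj; apply: nVx; exists j.
  by rewrite fx0 => /eqP; rewrite eq_sym oner_eq0.
exists (fun j => if j == p then f else g j); split.
- by move=> j; case: (eqVneq j p).
- by move=> j x; case: (eqVneq j p) => // _; have /andP[] := f01 x.
- move=> j x; case: (eqVneq j p) => [->|_ /gV //].
  by move=> fx; apply: contrapT => /f0 fx0; rewrite fx0 eqxx in fx.
- move=> x Cx; have [fx0|fx0] := eqVneq (f x) 0; last first.
    by exists p => //; rewrite eqxx.
  have [|j jp gj] := gC x; first by split.
  by exists j; [exact: ltnW|rewrite (ltn_eqF jp)].
Qed.

(** * Odd power sums and weighted series *)

(** A nonzero leading term has modulus [2 ^+ p], while the lower terms add up to at most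
    [2 ^+ p - 1]. *)
Lemma signed_binary_sum (R : realFieldType) (p : nat) (c : nat -> R) :
  (forall j, c j = 0 \/ `|c j| = 1) ->
  \sum_(j < p) 2 ^+ j * c j = 0 -> forall j, (j < p)%N -> c j = 0.
Proof.
move=> c01; elim: p => // p IH; rewrite big_ord_recr /= => sum0.
have le_sum : `|\sum_(j < p) 2 ^+ j * c j| <= 2 ^+ p - 1.
  elim: p {IH sum0} => [|p IH]; first by rewrite big_ord0 normr0 expr0 subrr.
  rewrite big_ord_recr /= (le_trans (ler_normD _ _))//.
  have : `|2 ^+ p * c p| <= 2 ^+ p :> R.
    rewrite normrM ger0_norm ?exprn_ge0// ler_piMr ?exprn_ge0//.
    by case: (c01 p) => ->; rewrite ?normr0.
  rewrite exprS; lra.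
have cp0 : c p = 0.
  case: (c01 p) => // cp1; have : `|2 ^+ p * c p| = 2 ^+ p :> R.
    by rewrite normrM cp1 mulr1 ger0_norm ?exprn_ge0.
  move: sum0 => /eqP; rewrite addr_eq0 => /eqP sum0.
  move: le_sum; rewrite sum0 normrN => + E; rewrite E; lra.
move=> j; rewrite ltnS leq_eqVlt => /predU1P[-> //|]; apply: IH.
by move: sum0; rewrite cp0 mulr0 addr0.
Qed.

(* The weights [2 ^+ j] prevent cancellation between equal and opposite values
   of [u]; distinct values of [u j ^+ 2] are told apart by interpolation. *)
Lemma odd_power_sum_neq0 (R : realFieldType) (p N : nat) (u : nat -> R) :
  (count (fun j => u j != 0%R) (iota 0 p) <= N)%N ->
  (exists2 j, (j < p)%N & u j != 0) ->
  exists2 i, (i < N)%N & \sum_(j < p) 2 ^+ j * u j ^+ i.*2.+1 != 0.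
Proof.
move=> leN [j0 j0p uj0]; apply: contrapT => sums0.
pose js := [seq j <- iota 0 p | u j != 0].
pose w0 := u j0 ^+ 2.
(* [q] kills every nonzero square [u j ^+ 2] other than [w0]. As [j0] contributes no factor,
   [size q], one more than the number of factors, is at most [N]. *)
pose q := \prod_(j <- [seq j <- js | u j ^+ 2 != w0]) ('X - (u j ^+ 2)%:P).
have sq : (size q <= N)%N.
  rewrite size_prod_XsubC size_filter; apply: leq_trans leN.
  have -> : count (fun j => u j != 0%R) (iota 0 p) = size js.
    by rewrite size_filter.
  rewrite -(count_predC (fun j => u j ^+ 2 != w0) js).
  rewrite -addn1 leq_add2l -has_count; apply/hasP; exists j0.
    by rewrite mem_filter uj0 mem_iota add0n.
  by rewrite /= /w0 eqxx.
have qw0 : q.[w0] != 0.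
  rewrite horner_prod prodf_seq_neq0; apply/allP => j.
  by rewrite mem_filter => /andP[jw _]; rewrite !hornerE subr_eq0 eq_sym.
have qroot j : (j < p)%N -> u j != 0 -> u j ^+ 2 != w0 -> q.[u j ^+ 2] = 0.
  move=> jp uj ujw; apply/eqP; rewrite -rootE /q -(big_map (fun j => u j ^+ 2)
    xpredT (fun w => 'X - w%:P)) root_prod_XsubC.
  by apply/mapP; exists j => //; rewrite !mem_filter ujw uj mem_iota add0n.
(* The sign of [u j] relative to [u j0] where the squares agree. *)
pose c j := if u j ^+ 2 == w0 then u j / u j0 else 0.
have c01 j : c j = 0 \/ `|c j| = 1.
  rewrite /c; case: eqP => [ujw|_]; [right|by left].
  rewrite normf_div; have : `|u j| ^+ 2 == `|u j0| ^+ 2.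
    by rewrite -!normrX ujw.
  by rewrite eqrXn2// => /eqP ->; rewrite divff// normr_eq0.
suff /(signed_binary_sum R p c c01)/(_ j0 j0p)/eqP :
    \sum_(j < p) 2 ^+ j * c j = 0.
  by rewrite /c eqxx divff// oner_eq0.
(* Weighted by the coefficients of [q], the power sums add up to [u j0 * q.[w0]] times the signed
   binary sum. *)
apply: (mulfI (mulf_neq0 uj0 qw0)); rewrite mulr0 mulr_sumr.
transitivity (\sum_(j < p) 2 ^+ j * u j * q.[u j ^+ 2]).
  apply: eq_bigr => j _; rewrite /c.
  case: (eqVneq (u j ^+ 2) w0) => [->|ujw].
    by field.
  rewrite !mulr0; have [->|uj] := eqVneq (u j) 0; first by rewrite mulr0 mul0r.
  by rewrite qroot// mulr0.
transitivity (\sum_(i < N) q`_i * \sum_(j < p) 2 ^+ j * u j ^+ i.*2.+1).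
  under eq_bigr do rewrite (horner_coef_wide _ sq) mulr_sumr.
  rewrite exchange_big /=; apply: eq_bigr => i _; rewrite mulr_sumr.
  apply: eq_bigr => j _.
  have -> : u j ^+ i.*2.+1 = u j * (u j ^+ 2) ^+ i.
    by rewrite -exprM mul2n -exprS.
  by ring.
rewrite big1// => i _; apply/eqP; rewrite mulf_eq0; apply/orP; right.
by apply/negPn/negP => s0; apply: sums0; exists i.
Qed.

Lemma continuous_sum (R : realType) (X : topologicalType) (n : nat)
    (f : nat -> X -> R) :
  (forall k, continuous (f k)) -> continuous (fun x => \sum_(k < n) f k x).
Proof.
move=> cf; elim: n => [|n IH] x.
  under eq_fun do rewrite big_ord0; exact: cvg_cst.
under eq_fun do rewrite big_ord_recr /=.
by apply: continuousD; [exact: IH|exact: cf].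
Qed.

(** The distances to the partial sums pin [F] down, so identities such as oddness pass to it through
    [half_expr_small]. *)
Lemma weighted_series (R : realType) (X : topologicalType)
    (f : nat -> X -> R) :
  (forall k, continuous (f k)) -> (forall k x, `|f k x| <= 1) ->
  exists F : X -> R, continuous F /\ forall x m,
    `|F x - \sum_(k < m) 2^-1 ^+ k.+1 * f k x| <= 2^-1 ^+ m.
Proof.
move=> cf f1; pose h : R := 2^-1; have h0 : 0 <= h by rewrite invr_ge0.
pose s x : nat -> R := series (fun k => h ^+ k.+1 * f k x).
have sE x m : s x m = \sum_(k < m) h ^+ k.+1 * f k x.
  by rewrite /s /series /= big_mkord.
have fh k x : `|h ^+ k.+1 * f k x| <= h ^+ k.+1.
  by rewrite normrM ger0_norm ?exprn_ge0// ler_piMr ?exprn_ge0.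
have cs x : cvgn (s x).
  apply: normed_cvg; apply: (@series_le_cvg R _ (geometric h h)) => //.
  - by move=> n; exact: normr_ge0.
  - by move=> n; rewrite /geometric mulr_ge0 ?exprn_ge0.
  - by move=> n; rewrite /geometric /= -exprS; exact: fh.
  - apply: is_cvg_geometric_series.
    by rewrite ger0_norm// invf_lt1// ltr1n.
have tail x m n : `|s x (m + n)%N - s x m| <= h ^+ m - h ^+ (m + n).
  elim: n => [|n IH]; first by rewrite addn0 !subrr normr0.
  rewrite addnS !sE big_ord_recr /= -!sE addrAC (le_trans (ler_normD _ _))//.
  have := fh (m + n)%N x; have : 2 * h = 1 by rewrite divff.
  rewrite exprS; nra.
pose F x := limn (s x).
have approx x m : `|F x - \sum_(k < m) h ^+ k.+1 * f k x| <= h ^+ m.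
  rewrite -sE; have cvs : `|s x n - s x m| @[n --> \oo] --> `|F x - s x m|.
    by apply: cvg_norm; apply: cvgB; [exact: cs|exact: cvg_cst].
  rewrite -(cvg_lim _ cvs)//; apply: limr_le; first by apply/cvg_ex; eexists; exact: cvs.
  exists m => // n /= mn; rewrite -(subnKC mn).
  by rewrite (le_trans (tail _ _ _))// lerBlDr lerDl exprn_ge0.
exists F; split=> // x; apply/cvgrPdist_lt => eps eps0.
pose m := Num.bound (3 / eps).
have hm : h ^+ m < eps / 3.
  have : 3 / eps < 2 ^+ m by apply: upper_nthrootP.
  rewrite /h exprVn -[eps / 3]invf_div ltf_pV2// posrE ?exprn_gt0//.
  by rewrite divr_gt0.
have cS : {for x, continuous (fun y => \sum_(k < m) h ^+ k.+1 * f k y)}.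
  apply: (continuous_sum _ _ _ (fun k y => h ^+ k.+1 * f k y)) => k y.
  by apply: cvgM; [exact: cvg_cst|exact: cf].
move/cvgrPdist_lt : cS => /(_ (eps / 3)); rewrite divr_gt0// => /(_ isT).
apply: filterS => y.
have := approx x m; have := approx y m; move: hm.
rewrite !ler_norml !ltr_norml => ? /andP[? ?] /andP[? ?] /andP[? ?].
apply/andP; split; lra.
Qed.

(** * Odd functions on finite-dimensional F-spaces *)

(** The point is the count [n.+1.*2], which depends on neither [m] nor [C]. *)
Lemma finite_odd_family (R : realType) (X : topologicalType) (sg : X -> X)
    (n m : nat) (C : set X) (f : nat -> X -> R) :
  normal_space X -> covering_dim_le X n ->
  continuous sg -> involutive sg -> closed C -> (forall x, C x -> C (sg x)) ->
  (forall k, continuous (f k)) -> (forall k x, f k (sg x) = - f k x) ->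
  (forall x, C x -> exists2 k, (k < m)%N & f k x != 0) ->
  exists F : nat -> X -> R, [/\ forall i, continuous (F i),
    forall i x, `|F i x| <= 1, forall i x, F i (sg x) = - F i x &
    forall x, C x -> exists2 i, (i < n.+1.*2)%N & F i x != 0].
Proof.
move=> nX dimX csg sgK clC sgC cf fodd fC.
pose pos k := [set x | 0 < f k x]; pose neg k := [set x | f k x < 0].
pose U : set (set X) := [set ~` C] `|` (pos @` `I_m `|` neg @` `I_m).
have [||D [finD [oD covD] DU ordD]] := dimX U.
- rewrite !finite_setU; split; first exact: finite_set1.
  by split; apply: finite_image; exact: finite_II.
- split=> [W [->|[[k _ <-]|[k _ <-]]]|x].
  + exact: closed_openC.
  + apply: (@open_comp _ _ (f k) [set y | 0 < y]); last exact: open_gt.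
    by move=> x _; exact: cf.
  + apply: (@open_comp _ _ (f k) [set y | y < 0]); last exact: open_lt.
    by move=> x _; exact: cf.
  + have [Cx|nCx] := pselect (C x); last by exists (~` C) => //; left.
    have [k km fkx] := fC x Cx; have [fk|fk] := ltP 0 (f k x).
      by exists (pos k) => //; right; left; exists k.
    exists (neg k); first by right; right; exists k.
    by rewrite /neg /= lt_neqAle fkx.
move/finite_seqP : finD => [s0 Ds0]; pose vs := undup s0.
have Dvs W : D W = (W \in vs) by rewrite Ds0 /= mem_undup.
pose V j := nth set0 vs j; pose p := size vs.
have DV j x : V j x -> (j < p)%N /\ D (V j).
  move=> Vx; have jp : (j < p)%N.
    by rewrite ltnNge; apply/negP => pj; move: Vx; rewrite /V nth_default.
  by split=> //; rewrite Dvs mem_nth.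
have oV j : open (V j).
  have [jp|pj] := ltnP j p; first by apply: oD; rewrite Dvs mem_nth.
  by rewrite /V nth_default//; exact: open0.
have [|g [cg _ gV gX]] := subordinate_functions R X V p setT nX oV closedT.
  move=> x _; have [W] := covD x; rewrite Dvs => Wvs Wx.
  by exists (index W vs); rewrite ?index_mem// /V nth_index.
pose u x j := g j x - g j (sg x).
(* A [V j] meeting [C] at [x] lies in some [pos k] or [neg k]. As [sg] exchanges these two, [V j]
   cannot also contain [sg x]. *)
have g_sg x j : C x -> g j x != 0 -> g j (sg x) = 0.
  move=> Cx /gV Vx; apply: contrapT => /eqP/gV Vsx.
  have [_ /DU[W UW VW]] := DV j x Vx.
  case: UW (VW _ Vx) (VW _ Vsx) => [->|[[k _ <-]|[k _ <-]]] //.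
    by rewrite /pos /= fodd; lra.
  by rewrite /neg /= fodd; lra.
have count_g x : (count (fun j => g j x != 0%R) (iota 0 p) <= n.+1)%N.
  rewrite -size_filter -(size_map V); apply: (ordD x).
    rewrite map_inj_in_uniq ?filter_uniq ?iota_uniq// => i j.
    rewrite !mem_filter !mem_iota !add0n /= => /andP[_ ip] /andP[_ jp] /eqP.
    by rewrite nth_uniq// ?undup_uniq// => /eqP.
  by move=> W /mapP[j]; rewrite mem_filter => /andP[/gV Vx _] ->; split=> //;
    case: (DV j x Vx).
pose S i x := \sum_(j < p) 2 ^+ j * u x j ^+ i.*2.+1.
have cS i : continuous (S i).
  apply: (continuous_sum _ _ _ (fun j x => 2 ^+ j * u x j ^+ i.*2.+1)) => j x.
  apply: cvgM; first exact: cvg_cst.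
  apply: (@continuous_comp _ _ _ (u^~ j) (fun y => y ^+ i.*2.+1)).
    apply: cvgB; first exact: cg.
    by apply: continuous_comp; [exact: csg|exact: cg].
  exact: exprn_continuous.
have Sodd i x : S i (sg x) = - S i x.
  rewrite /S -sumrN; apply: eq_bigr => j _.
  have -> : u (sg x) j = - u x j by rewrite /u sgK opprB.
  by rewrite exprNn -signr_odd /= odd_double expr1 mulN1r mulrN.
(* Truncation to [-1, 1] preserves oddness and the zero set. *)
exists (fun i x => Num.max (-1) (Num.min 1 (S i x))); split.
- move=> i x; apply: (@continuous_max R X (cst (-1)) (cst 1 \min S i)).
    exact: cvg_cst.
  by apply: continuous_min; [exact: cvg_cst|exact: cS].
- by move=> i x; rewrite ler_norml maxElt minElt; do 2 case: ifP; lra.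
- move=> i x; rewrite Sodd !maxElt !minElt.
  by do 4 (case: ifP => //=); lra.
- move=> x Cx; have [||i iN Si] := odd_power_sum_neq0 R p n.+1.*2 (u x).
  (* [u x j != 0] forces [g j x != 0] or [g j (sg x) != 0], and each occurs for at most [n.+1]
     indices. *)
  + apply: leq_trans (_ : _ <= n.+1 + n.+1)%N _; last by rewrite addnn.
    apply: leq_trans (leq_add (count_g x) (count_g (sg x))).
    rewrite -count_predUI; apply: leq_trans (leq_addr _ _).
    apply: sub_count => j /=; apply: contraR; rewrite negb_or !negbK.
    by move=> /andP[/eqP gx /eqP gsx]; rewrite /u gx gsx subrr.
  + have [j jp gj] := gX x I; exists j => //.
    by rewrite /u g_sg// subr0.
  + exists i => //; move: Si; rewrite -/(S i x) maxElt minElt.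
    by do 2 (case: ifP => //); lra.
Qed.

Lemma F_space_odd_vanish (X : topologicalType) (sg : X -> X) (e : X)
    (F : X -> Rl) :
  F_space X -> continuous sg -> sg e = e -> continuous F ->
  (forall x, F (sg x) = - F x) -> nbhs e [set x | F x = 0].
Proof.
move=> fsX csg sge cF Fodd.
pose P x := Num.max 0 (F x); pose Q x := Num.max 0 (- F x).
have cP : continuous P.
  move=> x; apply: (@continuous_max Rl X (cst 0) F); last exact: cF.
  exact: cvg_cst.
have cQ : continuous Q.
  move=> x; apply: (@continuous_max Rl X (cst 0) (fun y => - F y)).
    exact: cvg_cst.
  by apply: continuousN; exact: cF.
have coP x : 0 < F x -> cozero P x.
  by move=> Fx; rewrite /cozero /P /= maxElt Fx gt_eqF.
have coQ x : F x < 0 -> cozero Q x.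
  by move=> Fx; rewrite /cozero /Q /= maxElt oppr_gt0 Fx gt_eqF ?oppr_gt0.
have [|chi [cchi [chi0 chi1]]] := fsX P Q cP cQ.
  apply/seteqP; split=> // x; rewrite /cozero /P /Q /= !maxElt.
  by case: ifP => [? []|? []]; case: ifP => //; rewrite ?eqxx//; lra.
have nchi (c : Rl) : chi e <> c -> nbhs e [set x | chi x <> c].
  move=> ec; apply: (cchi e (~` [set c])); apply: open_nbhs_nbhs; split=> //.
  exact/closed_openC/closed_eq.
have nsg (N : set X) : nbhs e N -> nbhs e (sg @^-1` N).
  by rewrite -{1}sge => /csg.
(* If [chi e = 0], then for [x] near [e] neither [x] nor [sg x] lies where [chi] is 1, so neither
   [F x] nor [F (sg x) = - F x] is negative. The other case is symmetric. *)
have [chie|chie] := eqVneq (chi e) 0.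
- have /nchi N1 : chi e <> 1 by rewrite chie; apply/eqP; rewrite eq_sym oner_eq0.
  apply: filterS2 N1 (nsg _ N1) => x /= x1 sx1.
  have [Fx|Fx|//] := ltgtP (F x) 0; first by case: x1; exact/chi1/coQ.
  by case: sx1; apply/chi1/coQ; rewrite Fodd oppr_lt0.
- move/eqP/nchi : chie => N0; apply: filterS2 N0 (nsg _ N0) => x /= x0 sx0.
  have [Fx|Fx|//] := ltgtP (F x) 0; last by case: x0; exact/chi0/coP.
  by case: sx0; apply/chi0/coP; rewrite Fodd oppr_gt0.
Qed.

Lemma continuous_normr (R : realType) (X : topologicalType) (f : X -> R) :
  continuous f -> continuous (fun x => `|f x|).
Proof. by move=> cf x; apply: cvg_norm; exact: cf. Qed.

(** Turns the error bounds of [weighted_series] into equalities; the factor 2 leaves room for two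
    such bounds, [m0] for estimates that hold only for late partial sums. *)
Lemma half_expr_small (R : realType) (m0 : nat) (x : R) :
  (forall m, (m0 <= m)%N -> `|x| <= 2 * 2^-1 ^+ m) -> x = 0.
Proof.
move=> small; apply: contrapT => /eqP x0; have xgt0 : 0 < `|x| by rewrite normr_gt0.
pose m := maxn m0 (Num.bound (2 / `|x|)).
have := small m (leq_maxl _ _); apply/negP; rewrite -ltNge exprVn.
rewrite ltr_pdivrMr ?exprn_gt0// -ltr_pdivrMl// mulrC.
by apply: upper_nthrootP; exact: leq_maxr.
Qed.

(** For a single [f k] this is [F_space_odd_vanish]. A neighbourhood common to all [k] comes from
    applying that lemma to finitely many odd functions only, the sums [G] indexed by [pi] and
    [i]. *)
Lemma odd_family_vanish (X : topologicalType) (sg : X -> X) (n : nat) (e : X)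
    (f : nat -> X -> Rl) :
  normal_space X -> F_space X -> covering_dim_le X n ->
  continuous sg -> involutive sg -> sg e = e ->
  (forall k, continuous (f k)) -> (forall k x, `|f k x| <= 1) ->
  (forall k x, f k (sg x) = - f k x) ->
  nbhs e [set x | forall k, f k x = 0].
Proof.
move=> nX fsX dimX csg sgK sge cf f1 fodd.
have h0 m : 0 < (2^-1 ^+ m : Rl) by rewrite exprn_gt0// invr_gt0.
have hle i j : (i <= j)%N -> 2^-1 ^+ j <= (2^-1 ^+ i : Rl).
  by move=> ij; apply: ler_wiXn2l => //; rewrite ?invr_ge0// invf_le1// ler1n.
have [||Phi [cPhi PhiE]] := weighted_series Rl X (fun k x => `|f k x|).
- by move=> k; exact: continuous_normr.
- by move=> k x; rewrite normr_id.
have Phi_sg x : Phi (sg x) = Phi x.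
  apply/eqP; rewrite -subr_eq0; apply/eqP/(half_expr_small _ 0) => m _.
  have := PhiE x m; have := PhiE (sg x) m.
  under eq_bigr do rewrite fodd normrN.
  by rewrite !ler_norml => /andP[? ?] /andP[? ?]; apply/andP; split; lra.
have Phi_le1 x : Phi x <= 1.
  by have := PhiE x 0; rewrite big_ord0 subr0 expr0 ler_norml => /andP[].
have Phi_gt0 x k : f k x != 0 -> 0 < Phi x.
  move=> fk; rewrite ltNge; apply/negP => Phi0.
  have := f1 k x; move/eqP: fk; apply: contra_not => _.
  have fkh m : (k < m)%N -> 2^-1 ^+ k.+1 * `|f k x| <= 2^-1 ^+ m.
    move=> km; have := PhiE x m; rewrite (bigD1 (Ordinal km))//=.
    set S := (X in _ - (_ + X)); have : 0 <= S.
      by apply: sumr_ge0 => i _; rewrite mulr_ge0// ltW.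
    by rewrite ler_norml => ? /andP[? ?]; lra.
  have : 2^-1 ^+ k.+1 * `|f k x| = 0.
    apply: (half_expr_small _ k.+1) => m km.
    rewrite ger0_norm ?mulr_ge0// ?ltW//; have := fkh m km; have := h0 m; lra.
  by move/eqP; rewrite mulf_eq0 gt_eqF//= normr_eq0 => /eqP.
(* Twice the tail bound: where [a m <= Phi x], one of the first [m] functions [f k] is nonzero at
   [x]. *)
pose a m : Rl := 2 * 2^-1 ^+ m.
have ale i j : (i <= j)%N -> a j <= a i.
  by move=> ij; rewrite /a ler_pM2l//; exact: hle.
have agt0 i : 0 < a i by rewrite /a mulr_gt0.
have family m : exists F : nat -> X -> Rl, [/\ forall i, continuous (F i),
    forall i x, `|F i x| <= 1, forall i x, F i (sg x) = - F i x &
    forall x, a m <= Phi x -> exists2 i, (i < n.+1.*2)%N & F i x != 0].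
  apply: (finite_odd_family Rl X sg n m [set x | a m <= Phi x] f) => //.
  - apply: (proj1 (continuous_closedP Phi) cPhi [set y | a m <= y]).
    exact: closed_ge.
  - by move=> x; rewrite /= Phi_sg.
  - move=> x /= amx; apply: contrapT => nfx.
    have := PhiE x m; rewrite big1 ?subr0.
      by rewrite ler_norml => /andP[_]; move: amx; rewrite /a; have := h0 m; lra.
    move=> k _; suff -> : f k x = 0 by rewrite normr0 mulr0.
    by apply: contrapT => /eqP fk; apply: nfx; exists k.
have {family} [F Fprop] := choice family.
(* Nonzero exactly on the annulus [a m.+2 < Phi x < a m]. Consecutive annuli overlap, so together
   they cover [0 < Phi x <= 1]. *)
pose b m x := Num.max 0 (Num.min (Phi x - a m.+2) (a m - Phi x)).
have cb m : continuous (b m).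
  move=> x; apply: (@continuous_max Rl X (cst 0)
    ((fun x => Phi x - a m.+2) \min (fun x => a m - Phi x))).
    exact: cvg_cst.
  apply: (@continuous_min Rl); apply: cvgB; by [exact: cvg_cst|exact: cPhi].
have b_le1 m x : `|b m x| <= 1.
  have a2 : a m <= 2 by rewrite (le_trans (ale 0 m _))// /a expr0 mulr1.
  have := agt0 m.+2.
  rewrite ler_norml /b maxElt minElt; do 2 case: ifP; lra.
have b_neq0 m x : a m.+2 < Phi x -> Phi x < a m -> b m x != 0.
  by rewrite /b maxElt minElt; do 2 case: ifP; lra.
have b_eq0 m x : b m x != 0 -> a m.+2 < Phi x /\ Phi x < a m.
  rewrite /b maxElt minElt; do 2 case: ifP; rewrite ?eqxx//; lra.
(* Bumps whose indices have the same parity [pi] have disjoint supports, so the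
   odd functions of all annuli [a m.+2 < Phi < a m], [m = pi %[mod 2]], can be
   added up without cancellation. *)
pose T (pi : bool) i k x := b (k.*2 + pi)%N x * F (k.*2 + pi).+2 i x.
have sumT pi i : exists G : X -> Rl, continuous G /\ forall x m,
    `|G x - \sum_(k < m) 2^-1 ^+ k.+1 * T pi i k x| <= 2^-1 ^+ m.
  apply: (weighted_series Rl X (T pi i)).
    move=> k x; apply: continuousM; first exact: cb.
    by have [cF _ _ _] := Fprop (k.*2 + pi).+2; exact: cF.
  move=> k x; rewrite /T normrM; have [_ F1 _ _] := Fprop (k.*2 + pi).+2.
  by rewrite mulr_ile1.
(* Near [e] the sum [G] vanishes, so a nonzero summand cannot be alone; [T_unique] shows that it
   always is. *)
have Gvanish pi i : exists2 N, nbhs e N & forall x k, N x -> T pi i k x != 0 ->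
    exists2 k', k' != k & T pi i k' x != 0.
  have [G [cG GE]] := sumT pi i.
  exists [set x | G x = 0].
    apply: (F_space_odd_vanish X sg e G fsX csg sge cG) => x.
    apply/eqP; rewrite -subr_eq0 opprK; apply/eqP/(half_expr_small _ 0) => m _.
    have := GE x m; have := GE (sg x) m.
    have -> : \sum_(k < m) 2^-1 ^+ k.+1 * T pi i k (sg x) =
        - \sum_(k < m) 2^-1 ^+ k.+1 * T pi i k x.
      rewrite -sumrN; apply: eq_bigr => k _; rewrite /T.
      have [_ _ Fodd _] := Fprop (k.*2 + pi).+2.
      by rewrite /b Phi_sg Fodd !mulrN.
    by rewrite !ler_norml => /andP[? ?] /andP[? ?]; apply/andP; split; lra.
  move=> x k /= Gx0 Tk; apply: contrapT => only_k.
  have : 2^-1 ^+ k.+1 * T pi i k x = 0.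
    apply: (half_expr_small _ k.+1) => m km.
    have := GE x m; rewrite Gx0 (bigD1 (Ordinal km))//= big1 => [|j jk].
      by rewrite addr0 sub0r normrN => /le_trans; apply; have := h0 m; lra.
    suff -> : T pi i j x = 0 by rewrite mulr0.
    by apply: contrapT => /eqP Tj; apply: only_k; exists (val j).
  by apply/eqP; rewrite mulf_eq0 gt_eqF.
have T_unique pi i k k' x : T pi i k x != 0 -> T pi i k' x != 0 -> k = k'.
  have lt_disj j j' : (j < j')%N -> b (j.*2 + pi)%N x != 0 ->
      b (j'.*2 + pi)%N x != 0 -> False.
    move=> jj' /b_eq0[+ _] /b_eq0[_ +].
    have : a (j'.*2 + pi)%N <= a (j.*2 + pi).+2.
      by apply: ale; rewrite -addSn -addSn leq_add2r -doubleS leq_double.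
    move=> le_a lt1 lt2; suff : a (j.*2 + pi).+2 < a (j.*2 + pi).+2.
      by rewrite ltxx.
    exact: lt_le_trans (lt_trans lt1 lt2) le_a.
  rewrite /T !mulf_eq0 !negb_or => /andP[bk _] /andP[bk' _].
  by have [kk'|kk'|//] := ltngtP k k'; [case: (lt_disj k k')|case: (lt_disj k' k)].
have Nfin : nbhs e [set x | forall (pi : bool) (i : 'I_n.+1.*2) k,
    T pi i k x = 0].
  apply: filter_forall => pi; apply: filter_forall => i.
  have [N Ne NT] := Gvanish pi i; apply: filterS Ne => x Nx k.
  apply: contrapT => /eqP Tk; have [k' /eqP kk' Tk'] := NT x k Nx Tk.
  by apply: kk'; exact: T_unique Tk' Tk.
apply: filterS Nfin => x Tx0 k; apply: contrapT => /eqP/Phi_gt0 Px.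
have exm : exists m, a m < Phi x.
  apply: contrapT => nm; suff P0 : Phi x = 0 by rewrite P0 ltxx in Px.
  apply: (half_expr_small _ 0) => m _; rewrite ger0_norm ?(ltW Px)// leNgt.
  by apply/negP => ?; apply: nm; exists m.
(* The least index is at least 2, as [Phi x <= 1 = a 1 < a 0]. For [m.+2], minimality gives
   [Phi x <= a m.+1 < a m], so [x] lies in annulus [m], which has parity [odd m] and position
   [m./2]. *)
have [[|[|m]] am minm] := ex_minnP exm.
- by move: am; rewrite /a expr0; have := Phi_le1 x; lra.
- by move: am; rewrite /a expr1; have := Phi_le1 x; lra.
have Pm : Phi x < a m.
  have : Phi x <= a m.+1 by rewrite leNgt; apply/negP => /minm; rewrite ltnn.
  by rewrite /a exprS; have := h0 m; lra.
have [_ _ _ /(_ x (ltW am))[i iN Fi]] := Fprop m.+2.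
have := Tx0 (odd m) (Ordinal iN) m./2.
rewrite /T /= addnC odd_double_half => /eqP.
by rewrite mulf_eq0 (negPf Fi) orbF; apply/negP; exact: b_neq0.
Qed.

(** * Countably many odd functions from a countable uniformity *)

Lemma strict_well_order (T : eqType) : exists lt : T -> T -> Prop,
  (forall y z, y <> z -> lt y z \/ lt z y) /\
  (forall S : set T, S !=set0 -> exists2 y, S y & forall z, lt z y -> ~ S z).
Proof.
have [R woR] := wochoice.well_ordering_principle T.
have Rrefl x : R x x.
  have [|z [[zx lbz] _]] := woR (pred1 x); first by exists x; rewrite inE.
  by move: zx; rewrite inE => /eqP zx; rewrite -{1}zx; apply: lbz; rewrite inE.
exists (fun z y => ~~ R y z); split=> [y z yz|S [s Ss]].
  apply/orP; rewrite -negb_and; apply/negP => /andP[Rzy Ryz].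
  (* Antisymmetry of [R]: if both relations held, [y] and [z] would both be the unique least element
     of the pair. *)
  have [|w [_ wuniq]] := woR [predU1 y & pred1 z]; first by exists y; rewrite !inE eqxx.
  have wE x : x \in [predU1 y & pred1 z] -> (forall x', x' = y \/ x' = z -> R x x') ->
      w = x.
    move=> xyz Rx; apply: wuniq; split=> // x'; rewrite !inE => x'yz; apply: Rx.
    by case/orP: x'yz => /eqP; [left|right].
  have wy : w = y by apply: wE => [|x [] -> //]; rewrite !inE eqxx.
  have : w = z by apply: wE => [|x [] -> //]; rewrite !inE eqxx orbT.
  rewrite wy.
  by move=> zy; apply: yz.
have [|y [[yS lby] _]] := woR [pred x | `[< S x >]].
  by exists s; exact: (introT (asboolP (S s))).
exists y; first exact: (elimT (asboolP (S y))).
by move=> z /negP nR Sz; apply: nR; apply: lby; exact: (introT (asboolP (S z))).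
Qed.

(* [a] and [z] are joined by steps [E (m + k), ..., E m.+2, E m.+1]. *)
Fixpoint chain (T : Type) (E : nat -> T -> T -> Prop) (m k : nat) (a z : T)
    : Prop :=
  if k is k'.+1 then exists b, chain T E m.+1 k' a b /\ E m.+1 b z else a = z.

(** The steps shrink like a geometric series, so however long the chain is, it stays within
    [E m]. *)
Lemma chain_sub (T : Type) (E : nat -> T -> T -> Prop) (m k : nat) (a z : T) :
  (forall j x, E j x x) ->
  (forall j x y z, E j.+1 x y -> E j.+1 y z -> E j x z) ->
  chain T E m k a z -> E m a z.
Proof.
move=> Erefl Etrans; elim: k m z => [|k IH] m z /=; first by move=> ->.
by move=> [b [/IH ab bz]]; exact: Etrans ab bz.
Qed.

(** [chain] unfolds at its coarse end [z]; this adds a finer step at the other end, which is how a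
    small displacement of the starting point is absorbed. *)
Lemma chain_step (T : Type) (E : nat -> T -> T -> Prop) (m k : nat)
    (a b z : T) :
  E (m + k.+1)%N a b -> chain T E m k b z -> chain T E m k.+1 a z.
Proof.
elim: k m z => [|k IH] m z.
  by rewrite addn1 => Eab /= <-; exists a.
rewrite addnS -addSn => Eab [c [bc cz]].
by exists c; split=> //; exact: IH Eab bc.
Qed.

Lemma chain_map (T : Type) (E : nat -> T -> T -> Prop) (sg : T -> T)
    (m k : nat) (a z : T) :
  (forall j x y, E j x y -> E j (sg x) (sg y)) ->
  chain T E m k a z -> chain T E m k (sg a) (sg z).
Proof.
move=> Esg; elim: k m z => [|k IH] m z /=; first by move=> ->.
by move=> [b [/IH ab /Esg bz]]; exists (sg b).
Qed.

(* Stone's argument: a point [x] moved by [sg] by more than [E m] is assigned to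
   the well-order-least such [y] that has [x] or [sg x] at the end of a finite
   chain of [E m.+2, E m.+3, ...]-steps. For points with chains of the same
   length [k], choosing between [x] and [sg x] is uniformly consistent, because
   the chains of length [k.+1] absorb a displacement of size [E (m + k).+2]. *)
Lemma uniform_odd_family (R : realType) (X : topologicalType) (sg : X -> X)
    (E : nat -> X -> X -> Prop) :
  normal_space X -> continuous sg -> involutive sg ->
  (forall j x, E j x x) -> (forall j x y, E j x y -> E j y x) ->
  (forall j x y z, E j.+1 x y -> E j.+1 y z -> E j x z) ->
  (forall j x y, E j x y -> E j (sg x) (sg y)) ->
  (forall j x, nbhs x [set y | E j x y]) ->
  exists f : nat -> X -> R, [/\ forall k, continuous (f k),
    forall k x, `|f k x| <= 1, forall k x, f k (sg x) = - f k x &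
    forall j x, ~ E j x (sg x) -> exists k, f k x <> 0].
Proof.
move=> nX csg sgK Erefl Esym Etrans Esg Enbhs.
have [lt [lt_total lt_min]] := strict_well_order X.
pose B := chain X E; pose moved m y := ~ E m y (sg y).
pose A m k := [set x | exists y, [/\ moved m y, B m.+1 k x y &
  forall z, lt z y -> moved m z ->
    ~ B m.+1 k.+1 x z /\ ~ B m.+1 k.+1 x (sg z)]].
have B_step m k a b z : E (m + k.+1)%N a b -> B m k b z -> B m k.+1 a z.
  exact: chain_step.
have B_sg m k a z : B m k a z -> B m k (sg a) (sg z) by exact: chain_map.
(* If [y = y'], the chains from [b] to [y] and to [sg y] give [E m y (sg y)]. Otherwise the chain to
   the smaller of [y] and [y'], lengthened by the step between [a] and [b], contradicts the
   minimality of the larger. *)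
have A_sep m k a b : A m k a -> A m k (sg b) -> ~ E (m.+1 + k.+1)%N a b.
  move=> [y [my ay y_min]] [y' [my' by' y'_min]] ab.
  have {}by' : B m.+1 k b (sg y') by rewrite -(sgK b); exact: B_sg.
  have [yy'|/lt_total[lt_yy'|lt_y'y]] := pselect (y = y').
  - apply: my; apply: (Etrans _ _ b).
      by apply: (Esym); apply: (chain_sub X E _ k.+1 _ _ Erefl Etrans);
        apply: B_step ay; exact: Esym.
    by rewrite [in sg y]yy'; exact: (chain_sub X E _ k _ _ Erefl Etrans).
  - have [_] := y'_min y lt_yy' my; apply; apply: B_sg.
    by apply: B_step ay; exact: Esym.
  - by have [_] := y_min y' lt_y'y my'; apply; exact: B_step by'.
have family (mk : nat * nat) : exists f : X -> R, [/\ continuous f,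
    forall x, `|f x| <= 1, forall x, f (sg x) = - f x &
    forall x, A mk.1 mk.2 x -> f x = 1].
  case: mk => m k /=.
  have [|phi [cphi phi01 phi0 phi1]] := normal_urysohn R X (closure (A m k))
      (closure (sg @^-1` A m k)) nX (@closed_closure _ _) (@closed_closure _ _).
    apply/seteqP; split=> // x [clx clsx].
    have [a [Aa xa]] := clx _ (Enbhs (m.+1 + k.+1).+1 x).
    have [b [Ab xb]] := clsx _ (Enbhs (m.+1 + k.+1).+1 x).
    by apply: (A_sep m k a b) => //; apply: Etrans xb; exact: Esym.
  (* [phi] is 0 on [A m k] and 1 on its reflection, so the difference is 1 on [A m k]. *)
  exists (fun x => phi (sg x) - phi x); split.
  - move=> x; apply: cvgB; last exact: cphi.
    by apply: continuous_comp; [exact: csg|exact: cphi].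
  - move=> x; move: (phi01 x) (phi01 (sg x)) => /andP[? ?] /andP[? ?].
    by rewrite ler_norml; apply/andP; split; lra.
  - by move=> x; rewrite sgK opprB.
  - move=> x Ax; have -> : phi x = 0 by apply: phi0; exact: (subset_closure Ax).
    rewrite phi1 ?subr0//.
    have Asx : (sg @^-1` A m k) (sg x) by rewrite /= sgK.
    exact: (subset_closure Asx).
have {family} [f fP] := choice family.
exists (fun n => if unpickle n is Some mk then f mk else cst 0); split.
- move=> n; case: unpickle => [mk|]; first by case: (fP mk).
  exact: cst_continuous.
- by move=> n x; case: unpickle => [mk|]; [case: (fP mk)|rewrite normr0].
- by move=> n x; case: unpickle => [mk|]; [case: (fP mk)|rewrite oppr0].
move=> m x mx.
(* The set contains [x] itself, by the chain of length 0. Its least element puts [x] or [sg x] into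
   [A m k]. *)
have [|y [my [k xyk]] y_min] := lt_min [set y | moved m y /\
    exists k, B m.+1 k x y \/ B m.+1 k x (sg y)].
  by exists x; split=> //; exists 0%N; left.
have {}y_min z : lt z y -> moved m z ->
    ~ B m.+1 k.+1 x z /\ ~ B m.+1 k.+1 x (sg z).
  by move=> /y_min ny mz; split=> Bx; apply: ny; split=> //; exists k.+1;
    [left|right].
exists (pickle (m, k)); rewrite pickleK.
have [_ _ fodd fA] := fP (m, k).
have [xy|xy] := xyk.
  by rewrite fA; [apply/eqP; exact: oner_neq0|exists y].
rewrite -(sgK x) fodd fA; first by apply/eqP; rewrite oppr_eq0 oner_eq0.
exists y; split=> //; first by rewrite -(sgK y); exact: B_sg.
move=> z zy mz; have [nz nsz] := y_min z zy mz.
by split=> /B_sg; rewrite ?sgK.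
Qed.

(** * Topological groups *)

Lemma group_laws (G : topologicalType) (mul : G -> G -> G) (inv : G -> G)
    (e : G) : topological_group mul inv e ->
  [/\ forall x y z, mul x (mul y z) = mul (mul x y) z,
    forall x, mul e x = x, forall x, mul x e = x &
    [/\ forall x, mul (inv x) x = e, forall x, mul x (inv x) = e &
      forall x y, mul x y = e -> inv x = y]].
Proof.
move=> [mulA mule mulV _ _].
split=> [//|x|x|]; [by case: (mule x)|by case: (mule x)|].
split=> [x|x|x y xy]; [by case: (mulV x)|by case: (mulV x)|].
have [_ <-] := mule (inv x); rewrite -xy mulA; have [-> _] := mulV x.
by case: (mule y).
Qed.

(** Repeated square roots of neighbourhoods, each also shrunk into the next [W j], give a countable
    uniformity that tells [x] from [inv x] unless [mul x x = e]. *)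
Lemma gdelta_uniformity (G : topologicalType) (mul : G -> G -> G)
    (inv : G -> G) (e : G) :
  topological_group mul inv e -> Gdelta_point e ->
  exists E : nat -> G -> G -> Prop, [/\
    (forall j x, E j x x) /\ (forall j x y, E j x y -> E j y x),
    forall j x y z, E j.+1 x y -> E j.+1 y z -> E j x z,
    forall j x y, E j x y -> E j (inv x) (inv y),
    forall j x, nbhs x [set y | E j x y] &
    forall x, (forall j, E j x (inv x)) -> mul x x = e].
Proof.
move=> topG [W [oW WE]].
have [mulA mul1x mulx1 [mulVx mulxV inv_unique]] := group_laws G mul inv e topG.
have [_ _ _ cmul cinv] := topG.
have invK x : inv (inv x) = x by exact: inv_unique.
have We k : W k e.
  by have : (\bigcap_k W k) e; [rewrite WE|apply].
have square_root (N : set G) : exists V : set G, nbhs e N ->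
    [/\ open V, V e & forall x y, V x -> V y -> N (mul x y)].
  have [Ne|] := pselect (nbhs e N); last by exists setT.
  have : nbhs (mul (e, e).1 (e, e).2) N by rewrite /= (mul1x e).
  move=> /cmul[[P Q] /= [Pe Qe] PQ].
  exists (P `&` Q)°; split.
  - exact: open_interior.
  - exact: filterI.
  - by move=> x y /interior_subset[Px _] /interior_subset[_ Qy];
      exact: (PQ (x, y)).
have [V VP] := choice square_root.
pose U := fix U j := if j is j'.+1 then V (U j' `&` W j') else setT.
have nU j : open (U j) /\ U j e.
  elim: j => [|j [oU Ue]] /=; first by split=> //; exact: openT.
  have [|oV Ve _] := VP (U j `&` W j); last by [].
  by apply: open_nbhs_nbhs; split; [exact: openI|split].
have UU j x y : U j.+1 x -> U j.+1 y -> U j (mul x y) /\ W j (mul x y).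
  have [oU Ue] := nU j; have [|_ _ VV] := VP (U j `&` W j).
    by apply: open_nbhs_nbhs; split; [exact: openI|split].
  exact: VV.
have mulKV x y z : mul (mul (inv x) y) (mul (inv y) z) = mul (inv x) z.
  by rewrite mulA -(mulA (inv x)) (mulxV y) (mulx1 (inv x)).
have mulVK x y z : mul (mul x (inv y)) (mul y (inv z)) = mul x (inv z).
  by rewrite mulA -(mulA x) (mulVx y) (mulx1 x).
have cmul2 (f g : G -> G) : continuous f -> continuous g ->
    continuous (fun y => mul (f y) (g y)).
  move=> cf cg y; apply: (@continuous_comp _ _ _ (fun y => (f y, g y))
    (fun p => mul p.1 p.2)); last exact: cmul.
  by apply: cvg_pair; [exact: cf|exact: cg].
(* Left and right quotients, each in both directions: [inv] exchanges left with right, and symmetry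
   exchanges the directions. *)
exists (fun j x y => [/\ U j (mul (inv x) y), U j (mul (inv y) x),
  U j (mul x (inv y)) & U j (mul y (inv x))]); split.
- split=> [j x|j x y []//].
  by have [_ Ue] := nU j; rewrite (mulVx x) (mulxV x).
- move=> j x y z [a1 a2 a3 a4] [b1 b2 b3 b4]; split.
  + by rewrite -(mulKV x y z); case: (UU j _ _ a1 b1).
  + by rewrite -(mulKV z y x); case: (UU j _ _ b2 a2).
  + by rewrite -(mulVK x y z); case: (UU j _ _ a3 b3).
  + by rewrite -(mulVK z y x); case: (UU j _ _ b4 a4).
- by move=> j x y [? ? ? ?]; rewrite !invK.
- move=> j x.
  have nf (f : G -> G) : continuous f -> f x = e -> nbhs x (f @^-1` U j).
    move=> cf fx; apply: cf; rewrite fx; apply: open_nbhs_nbhs; exact: nU.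
  have cid : continuous (@id G) by move=> y; exact: cvg_id.
  have ccst (c : G) : continuous (fun _ : G => c) by exact: cst_continuous.
  have N1 := nf _ (cmul2 _ _ (ccst (inv x)) cid) (mulVx x).
  have N2 := nf _ (cmul2 _ _ cinv (ccst x)) (mulVx x).
  have N3 := nf _ (cmul2 _ _ (ccst x) cinv) (mulxV x).
  have N4 := nf _ (cmul2 _ _ cid (ccst (inv x))) (mulxV x).
  by apply: filterS (filterI (filterI N1 N2) (filterI N3 N4)) => y [[? ?] [? ?]].
- move=> x Ex; suff : (\bigcap_k W k) (mul x x) by rewrite WE.
  move=> k _; have [_ _ Uxx _] := Ex k.+1; rewrite invK in Uxx.
  by have [_ Ue] := nU k.+1; have [_] := UU k _ _ Uxx Ue; rewrite (mulx1 _).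
Qed.

Lemma square_trivial_near (G : topologicalType) (mul : G -> G -> G)
    (inv : G -> G) (e : G) :
  topological_group mul inv e -> normal_space G -> F_space G ->
  finite_dim G -> Gdelta_point e -> nbhs e [set x | mul x x = e].
Proof.
move=> topG nG fsG [n dimG] gdG.
have [E [[Erefl Esym] Etrans Einv Enbhs Esq]] := gdelta_uniformity G mul inv e topG gdG.
have [_ _ mulx1 [mulVx _ inv_unique]] := group_laws G mul inv e topG.
have [_ _ _ cmul cinv] := topG.
have invK x : inv (inv x) = x by exact: inv_unique.
have inve : inv e = e by exact: inv_unique.
have [f [cf f1 fodd fE]] := uniform_odd_family Rl G inv E nG cinv invK
  Erefl Esym Etrans Einv Enbhs.
apply: filterS (odd_family_vanish G inv n e f nG fsG dimG cinv invK inve cf f1 fodd).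
move=> x fx0; apply: Esq => j; apply: contrapT => /fE[k]; apply; exact: fx0.
Qed.

Lemma open_boolean_subgroup (G : topologicalType) (mul : G -> G -> G)
    (inv : G -> G) (e : G) :
  topological_group mul inv e -> nbhs e [set x | mul x x = e] ->
  exists H : set G, [/\ open H, H e, forall x y, H x -> H y -> H (mul x y),
    forall x, H x -> H (inv x) & forall x, H x -> mul x x = e].
Proof.
move=> topG sq.
have [mulA mul1x mulx1 [mulVx mulxV inv_unique]] := group_laws G mul inv e topG.
have [_ _ _ cmul cinv] := topG.
have : nbhs (mul (e, e).1 (e, e).2) [set x | mul x x = e] by rewrite /= (mul1x e).
move=> /cmul[[P Q] /= [Pe Qe] PQ].
pose V := [set x | P x /\ Q x /\ mul x x = e].
have nV : nbhs e V by apply: filterI => //; exact: filterI.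
(* The elements [x], [y] and [mul x y] all square to [e], so each is its own inverse. *)
have VC x y : V x -> V y -> mul x y = mul y x.
  move=> [Px [_ xx]] [_ [Qy yy]]; have /= xyxy := PQ (x, y) (conj Px Qy).
  have <- := inv_unique _ _ xyxy; apply: inv_unique.
  by rewrite mulA -(mulA x) yy (mulx1 x).
(* Finite products from [V]; by [Hsq] each is its own inverse, which makes [H] closed under
   [inv]. *)
pose H := [set x | exists s : seq G, (forall v, v \in s -> V v) /\
  x = foldr mul e s].
have HV v s : V v -> (forall v, v \in s -> V v) ->
    mul v (foldr mul e s) = mul (foldr mul e s) v.
  move=> Vv; elim: s => [|w s IH] /= Vs; first by rewrite (mul1x v) (mulx1 v).
  rewrite mulA (VC v w)// -?mulA ?IH//; last by apply: Vs; rewrite inE eqxx.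
  by move=> u us; apply: Vs; rewrite inE us orbT.
have HM x y : H x -> H y -> H (mul x y).
  move=> [s [Vs ->]] [t [Vt ->]]; exists (s ++ t); split.
    by move=> v; rewrite mem_cat => /orP[/Vs|/Vt].
  by elim: s {Vs} => [|v s IH] /=; rewrite ?(mul1x _)// -mulA IH.
have Hsq x : H x -> mul x x = e.
  move=> [s [Vs ->]]; elim: s Vs => [|v s IH] Vs /=; first by rewrite (mul1x e).
  have Vv : V v by apply: Vs; rewrite inE eqxx.
  have Vs' u : u \in s -> V u by move=> us; apply: Vs; rewrite inE us orbT.
  rewrite mulA -(mulA v) -HV// mulA; have [_ [_ ->]] := Vv.
  by rewrite (mul1x _) IH.
have He : H e by exists [::].
exists H; split=> //; last by move=> x Hx; rewrite (inv_unique x x)//; exact: Hsq.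
rewrite openE => x Hx.
have cx : {for x, continuous (mul (inv x))}.
  apply: (@continuous_comp _ _ _ (fun y => (inv x, y))
    (fun p => mul p.1 p.2)); last exact: cmul.
  by apply: cvg_pair; [exact: cvg_cst|exact: cvg_id].
(* The translate of [V] by [x] is a neighbourhood of [x] inside [H]. *)
have : nbhs x (mul (inv x) @^-1` V) by apply: cx; rewrite /= (mulVx x).
apply: filterS => y Vy; have -> : y = mul x (mul (inv x) y).
  by rewrite mulA (mulxV x) (mul1x y).
apply: HM => //; exists [:: mul (inv x) y]; rewrite /= (mulx1 _); split=> //.
by move=> v; rewrite inE => /eqP ->.
Qed.

(** * Clopen subspaces *)

Lemma set_val_inj (X : Type) (A : set X) : injective (@set_val X A).
Proof. exact: val_inj. Qed.
Arguments set_val_inj {X A}.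

Lemma set_type_point (X : Type) (A : set X) (a : X) :
  A a -> exists y : set_type A, set_val y = a.
Proof. by move=> Aa; exists (SigSub (mem_set Aa)). Qed.
Arguments set_type_point {X A a}.

Lemma continuous_set_val (X : topologicalType) (A : set X) :
  continuous (@set_val X A).
Proof. exact: initial_continuous. Qed.

Lemma open_set_val_image (X : topologicalType) (A : set X)
    (W : set (set_type A)) : open A -> open W -> open (set_val @` W).
Proof.
move=> oA [V oV <-]; rewrite (_ : _ @` _ = V `&` A); first exact: openI.
apply/seteqP; split=> [x [y Vy <-]|x [Vx /set_type_point[y yx]]].
  by split=> //; exact: set_valP.
by exists y => //=; rewrite yx.
Qed.

Lemma set_val_image_preimage (X : Type) (A : set X) (W : set (set_type A)) :
  set_val @^-1` (set_val @` W) = W.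
Proof.
apply/seteqP; split=> [y [w Ww]|y Wy]; last by exists y.
by move=> /set_val_inj <-.
Qed.

Lemma set_val_image_inj (X : Type) (A : set X) :
  injective (fun W : set (set_type A) => set_val @` W).
Proof.
move=> V W VW; rewrite -(set_val_image_preimage X A V).
by rewrite -(set_val_image_preimage X A W) /= VW.
Qed.

Lemma hausdorff_set_type (X : topologicalType) (A : set X) :
  hausdorff_space X -> hausdorff_space (set_type A).
Proof.
move=> hX y z yz; apply: set_val_inj; apply: hX => P Q Py Qz.
have [w [Pw Qw]] := yz _ _ (continuous_set_val X A y P Py)
  (continuous_set_val X A z Q Qz).
by exists (set_val w).
Qed.

(** Extension by zero adds nothing to the cozero set, so disjoint cozero sets of the subspace can be
    separated in [X]. *)
Lemma clopen_extension (R : realType) (X : topologicalType) (A : set X)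
    (f : set_type A -> R) :
  open A -> closed A -> continuous f ->
  exists F : X -> R, [/\ continuous F, forall y, F (set_val y) = f y &
    forall x, ~ A x -> F x = 0].
Proof.
move=> oA cA cf.
have /choice[F FP] x : exists r : R,
    (forall y : set_type A, set_val y = x -> r = f y) /\ (~ A x -> r = 0).
  have [/set_type_point[y yx]|nAx] := pselect (A x).
    exists (f y); split=> [z|]; first by rewrite -yx => /set_val_inj ->.
    by rewrite -yx; case; exact: set_valP.
  by exists 0; split=> // y yx; case: nAx; rewrite -yx; exact: set_valP.
have FE y : F (set_val y) = f y by apply: (FP (set_val y)).1.
exists F; split=> [x N|//|x]; last exact: (FP x).2.
have [/set_type_point[y <-]|nAx] := pselect (A x).
  rewrite FE => /cf; rewrite /nbhs /= => -[W [[V oV <-] Vy] VN].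
  have Ay : A (set_val y) by exact: set_valP.
  apply: filterS (open_nbhs_nbhs (conj (openI oV oA) (conj Vy Ay))).
  move=> z [Vz /set_type_point[w wz]]; rewrite -wz in Vz *.
  by rewrite /= FE; exact: VN.
rewrite (FP x).2// => /nbhs_singleton N0.
apply: filterS (open_nbhs_nbhs (conj (closed_openC cA) nAx)) => z nAz.
by rewrite /= (FP z).2.
Qed.

Lemma F_space_clopen (X : topologicalType) (A : set X) :
  open A -> closed A -> F_space X -> F_space (set_type A).
Proof.
move=> oA cA fsX f g cf cg fg0.
have [F [cF FE F0]] := clopen_extension Rl X A f oA cA cf.
have [H [cH HE H0]] := clopen_extension Rl X A g oA cA cg.
have [|chi [cchi [chi0 chi1]]] := fsX F H cF cH.
  apply/seteqP; split=> // x [].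
  have [/set_type_point[y <-]|nAx] := pselect (A x); last first.
    by rewrite /cozero /= F0// eqxx.
  by rewrite /cozero /= FE HE => fy gy; rewrite -[False]/(set0 y) -fg0.
exists (chi \o set_val); split; last split.
- by move=> y; apply: continuous_comp;
    [exact: continuous_set_val|exact: cchi].
- by move=> y fy; apply: chi0; rewrite /cozero /= FE.
- by move=> y gy; apply: chi1; rewrite /cozero /= HE.
Qed.

Definition cover_from_subtype (X : Type) (A : set X)
    (C : set (set (set_type A))) : set (set X) :=
  [set ~` A] `|` [set set_val @` W | W in C].

(** The empty set is left out: as a member of [D] it may be subordinate only to the complement of
    [A], and to nothing in the cover of the subspace. *)
Definition cover_to_subtype (X : Type) (A : set X) (D : set (set X))
    : set (set (set_type A)) :=
  [set W | D (set_val @` W) /\ W !=set0].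

Lemma open_cover_from_subtype (X : topologicalType) (A : set X)
    (C : set (set (set_type A))) :
  open A -> closed A -> open_cover C ->
  open_cover (cover_from_subtype X A C).
Proof.
move=> oA cA [oC covC]; split=> [U [->|[W CW <-]]|x].
- exact: closed_openC.
- by apply: open_set_val_image => //; exact: oC.
- have [/set_type_point[y <-]|nAx] := pselect (A x); last first.
    by exists (~` A) => //; left.
  have [W CW Wy] := covC y; exists (set_val @` W); last by exists y.
  by right; exists W.
Qed.

Lemma cover_to_subtype_refines (X : topologicalType) (A : set X)
    (C : set (set (set_type A))) (D : set (set X)) :
  open_cover D -> refines D (cover_from_subtype X A C) ->
  open_cover (cover_to_subtype X A D) /\ refines (cover_to_subtype X A D) C.
Proof.
move=> [oD covD] DC; split; [split|].
- move=> W [/oD oW _]; rewrite -(set_val_image_preimage X A W).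
  exact: (proj1 (continuousP _) (continuous_set_val X A) _ oW).
- move=> y; have [V DV Vy] := covD (set_val y).
  have [U [->|[W CW <-]] VU] := DC V DV.
    by case: (VU _ Vy); exact: set_valP.
  exists (set_val @^-1` V) => //; split; last by exists y.
  suff -> : set_val @` (@set_val X A @^-1` V) = V by [].
  apply/seteqP; split=> [x [z Vz <- //]|x Vx].
  by have [z _ zx] := VU x Vx; exists z => //=; rewrite zx.
- move=> W [DW [y Wy]]; have [U [->|[W' CW' <-]] WU] := DC _ DW.
    have : (~` A) (set_val y) by apply: WU; exists y.
    by case; exact: set_valP.
  exists W' => // z Wz; have [z' W'z' /set_val_inj <- //] : (set_val @` W') (set_val z).
  by apply: WU; exists z.
Qed.

Lemma paracompact_clopen (X : topologicalType) (A : set X) :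
  open A -> closed A -> paracompact X -> paracompact (set_type A).
Proof.
move=> oA cA [hX pX]; split; first exact: hausdorff_set_type.
move=> C covC.
have [D [covD DC lfD]] := pX _ (open_cover_from_subtype X A C oA cA covC).
exists (cover_to_subtype X A D).
have [covD' D'C] := cover_to_subtype_refines X A C D covD DC.
split=> // y; have [N Ny finN] := lfD (set_val y).
exists (set_val @^-1` N); first exact: (continuous_set_val X A y).
apply: sub_finite_set (finite_preimage _ finN); last first.
  by move=> V W _ _; exact: set_val_image_inj.
by move=> W [[DW _] [z [Wz Nz]]]; split=> //; exists (set_val z); split.
Qed.

Lemma covering_dim_clopen (X : topologicalType) (A : set X) (n : nat) :
  open A -> closed A -> covering_dim_le X n ->
  covering_dim_le (set_type A) n.
Proof.
move=> oA cA dimX C finC covC.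
have [|D [finD covD DC ordD]] := dimX (cover_from_subtype X A C) _
    (open_cover_from_subtype X A C oA cA covC).
  rewrite /cover_from_subtype finite_setU; split; first exact: finite_set1.
  exact: finite_image.
have [covD' D'C] := cover_to_subtype_refines X A C D covD DC.
exists (cover_to_subtype X A D); split=> //.
  apply: sub_finite_set (finite_preimage _ finD); last first.
    by move=> V W _ _; exact: set_val_image_inj.
  by move=> W [].
move=> y s us sD; rewrite -(size_map (fun W => set_val @` W) s).
apply: (ordD (set_val y)).
  by rewrite map_inj_uniq//; exact: set_val_image_inj.
by move=> V /mapP[W /sD[[DW _] Wy] ->]; split=> //; exists y.
Qed.

(** * Open subgroups as topological groups *)

Lemma open_subgroup_closed (G : topologicalType) (mul : G -> G -> G)
    (inv : G -> G) (e : G) (H : set G) :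
  topological_group mul inv e -> open H -> H e ->
  (forall x y, H x -> H y -> H (mul x y)) -> (forall x, H x -> H (inv x)) ->
  closed H.
Proof.
move=> topG oH He HM HI.
have [mulA mul1x mulx1 [mulVx mulxV _]] := group_laws G mul inv e topG.
have [_ _ _ cmul cinv] := topG.
move=> x clx; have cx : {for x, continuous (fun y => mul x (inv y))}.
  apply: (@continuous_comp _ _ _ (fun y => (x, inv y))
    (fun p => mul p.1 p.2)); last exact: cmul.
  by apply: cvg_pair; [exact: cvg_cst|exact: cinv].
(* Some [y] in [H] is so close to [x] that [mul x (inv y)] is in [H]; multiplying by [y] gives back
   [x]. *)
have [|y [Hy Hxy]] := clx ((fun y => mul x (inv y)) @^-1` H).
  by apply: cx; rewrite /= mulxV; exact: open_nbhs_nbhs.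
by rewrite -(mulx1 x) -(mulVx y) mulA; exact: HM.
Qed.

Theorem theorem1 (G : topologicalType) (mul : G -> G -> G) (inv : G -> G) (e : G) :
  topological_group mul inv e ->
  hausdorff_space G ->
  paracompact G ->
  F_space G ->
  finite_dim G ->
  Gdelta_point e ->
  exists H : set G,
    [/\ open H, H e /\
        (forall x y, H x -> H y -> H (mul x y)),
        (forall x, H x -> H (inv x)),
        (forall x, H x -> mul x x = e) &
        (exists (mulH : set_type H -> set_type H -> set_type H)
               (invH : set_type H -> set_type H) (eH : set_type H),
          [/\ (forall x y, set_val (mulH x y) = mul (set_val x) (set_val y)),
              (forall x, set_val (invH x) = inv (set_val x)),
              set_val eH = e,
              topological_group mulH invH eH &
              [/\ hausdorff_space (set_type H), paracompact (set_type H),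
                  F_space (set_type H), finite_dim (set_type H) &
                  Gdelta_point eH]])].
Proof.
move=> topG hG pG fsG [n dimG] gdG.
have nG := paracompact_normal G pG.
have [H [oH He HM HI Hsq]] := open_boolean_subgroup G mul inv e topG
  (square_trivial_near G mul inv e topG nG fsG (ex_intro _ n dimG) gdG).
have cH := open_subgroup_closed G mul inv e H topG oH He HM HI.
exists H; split=> //.
pose mulH (x y : set_type H) : set_type H :=
  SigSub (mem_set (HM _ _ (set_valP x) (set_valP y))).
pose invH (x : set_type H) : set_type H := SigSub (mem_set (HI _ (set_valP x))).
pose eH : set_type H := SigSub (mem_set He).
exists mulH, invH, eH; split=> //.
- have [mulA mule mulV cmul cinv] := topG; split.
  + by move=> x y z; apply: set_val_inj; exact: mulA.
  + by move=> x; have [? ?] := mule (set_val x); split; exact: set_val_inj.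
  + by move=> x; have [? ?] := mulV (set_val x); split; exact: set_val_inj.
  + apply: continuous_comp_initial => p.
    apply: (@continuous_comp _ _ _ (fun p : set_type H * set_type H =>
      (set_val p.1, set_val p.2)) (fun p => mul p.1 p.2)); last exact: cmul.
    apply: cvg_pair.
      by apply: continuous_comp; [exact: cvg_fst|exact: continuous_set_val].
    by apply: continuous_comp; [exact: cvg_snd|exact: continuous_set_val].
  + apply: continuous_comp_initial => x.
    apply: (@continuous_comp _ _ _ set_val inv); last exact: cinv.
    exact: continuous_set_val.
- split.
  + exact: hausdorff_set_type.
  + exact: paracompact_clopen.
  + exact: F_space_clopen.
  + by exists n; exact: covering_dim_clopen.
  + have [U [oU UE]] := gdG; exists (fun k => set_val @^-1` U k); split.
      move=> k; exact: (proj1 (continuousP _) (continuous_set_val G H) _ (oU k)).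
    apply/seteqP; split=> [y Uy|y -> k _]; last first.
      by have : (\bigcap_k U k) e by [rewrite UE]; apply.
    apply: set_val_inj; have : (\bigcap_k U k) (set_val y) by move=> k _; exact: Uy.
    by rewrite UE.
Qed.
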